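(* Let $G$ be a non-amenable torsion group (every element of $G$ has finite order). Then its Tarski number satisfies $\mathcal{T}(G)\ge 6$.
   Context: For a group $G$, let $\mathcal{G}_G$ be the set of bijections $\gamma\colon S\to T$ between subsets of $G$ for which there exist a finite partition $S=\bigsqcup_{1\le j\le n}S_j$ and elements $g_1,\dots,g_n\in G$ with $\gamma(x)=g_jx$ for all $x\in S_j$, $1\le j\le n$. The smallest possible such $n$ is the Tarski number of $\gamma$. The group $G$ is amenable if there is a finitely additive map $\mu$ from the set of all subsets of $G$ to $[0,1]$ with $\mu(G)=1$ and $\mu(T)=\mu(S)$ for every $\gamma\colon S\to T$ in $\mathcal{G}_G$. A paradoxical decomposition of $G$ consists of a partition $G=X_1\sqcup X_2$ and bijections $\gamma_1\colon X_1\to G$, $\gamma_2\colon X_2\to G$ in $\mathcal{G}_G$; its Tarski number is the sum of the Tarski numbers of $\gamma_1$ and $\gamma_2$. The Tarski number $\mathcal{T}(G)$ is the minimum of the Tarski numbers of the paradoxical decompositions of $G$ if $G$ is non-amenable (such decompositions then exist), and $\mathcal{T}(G)=\infty$ if $G$ is amenable. *)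

(* Defs.v *)
From HB Require Import structures.
From mathcomp Require Import all_boot all_order all_algebra.
From mathcomp Require Import boolp classical_sets functions.
From mathcomp Require Import reals constructive_ereal ereal.

Set Implicit Arguments.
Unset Strict Implicit.
Unset Printing Implicit Defensive.

Import Order.TTheory GRing.Theory Num.Theory.
Local Open Scope classical_set_scope.
Local Open Scope ring_scope.

Section TarskiNumber.
Variable G : groupType.

Definition torsion_group : Prop :=
  forall x : G, exists2 n : nat, (0 < n)%N & (x ^+ n)%g = 1%g.

(* A map between subsets of [G] is a total function [gamma : G -> G] of which
   only the values on the domain [S] matter. The pieces of a [partition] are
   nonempty, so the empty map has [n = 0]. *)
Definition translates_by_pieces (S : set G) (gamma : G -> G) (n : nat) : Prop :=
  exists (S_ : 'I_n -> set G) (g : 'I_n -> G),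
    partition setT S_ S /\ forall j x, S_ j x -> gamma x = (g j * x)%g.

Definition piecewise_translation (S T : set G) (gamma : G -> G) : Prop :=
  set_bij S T gamma /\ exists n, translates_by_pieces S gamma n.

Definition has_tarski_number (S : set G) (gamma : G -> G) (n : nat) : Prop :=
  translates_by_pieces S gamma n /\
  forall m, translates_by_pieces S gamma m -> (n <= m)%N.

Definition amenable (R : realType) : Prop :=
  exists mu : set G -> R,
    [/\ forall A, 0 <= mu A <= 1,
        forall A B, A `&` B = set0 -> mu (A `|` B) = mu A + mu B,
        mu setT = 1
      & forall S T gamma, piecewise_translation S T gamma -> mu T = mu S].

Definition paradoxical_decomposition (X1 X2 : set G) (gamma1 gamma2 : G -> G)
    : Prop :=
  [/\ X1 `|` X2 = setT, X1 `&` X2 = set0,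
      piecewise_translation X1 setT gamma1
    & piecewise_translation X2 setT gamma2].

Definition paradoxical_tarski_numbers : set nat :=
  [set n | exists X1 X2 gamma1 gamma2 n1 n2,
    [/\ paradoxical_decomposition X1 X2 gamma1 gamma2,
        has_tarski_number X1 gamma1 n1,
        has_tarski_number X2 gamma2 n2
      & n = (n1 + n2)%N]].

(* The infimum of a nonempty set of natural numbers is its minimum, and by
   Tarski's theorem the set is nonempty when [G] is not amenable. *)
Definition tarski_number (R : realType) : \bar R :=
  if `[< amenable R >] then +oo%E
  else ereal_inf [set (n%:R)%:E | n in paradoxical_tarski_numbers].

End TarskiNumber.

Arguments amenable : clear implicits.
Arguments torsion_group : clear implicits.
Arguments tarski_number : clear implicits.

(* Main.v *)
(* If X decomposes into A and B with G = gA cup hB, put u = h^-1 g.  A point x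
   outside A has g x = h b for some b in B, so u x lies in B and is again
   outside A.  Hence a point x outside A and B has all its translates u^k x
   (k > 0) in B, which is absurd when u has finite order.  So each half of a
   paradoxical decomposition of a torsion group has at least three pieces. *)
Require Import Defs.
From mathcomp Require Import all_boot all_order all_algebra.
From mathcomp Require Import boolp classical_sets functions.
From mathcomp Require Import reals constructive_ereal ereal.

Local Open Scope ereal_scope.

Lemma torsion_two_translates_cover (G : groupType) (htors : torsion_group G)
    (A B : set G) (g h : G) :
  (A `&` B = set0)%classic ->
  (forall y, (exists2 a, A a & y = (g * a)%g) \/
             (exists2 b, B b & y = (h * b)%g)) ->
  forall x, A x \/ B x.
Proof.
move=> AB0 cov x.
have [Ax|nAx] := pselect (A x); first by left.
right; set u := (h^-1 * g)%g.
have step y : ~ A y -> B (u * y)%g.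
  move=> nAy; case: (cov (g * y)%g) => [[a Aa /mulgI ya]|[b Bb gyE]].
    by rewrite ya in nAy.
  by rewrite /u -mulgA gyE mulKg.
have iterB k : B (u ^+ k.+1 * x)%g.
  elim: k => [|k IHk]; first by rewrite expg1; apply: step.
  rewrite expgS -mulgA; apply: step => Ak.
  by have : (A `&` B)%classic (u ^+ k.+1 * x)%g by []; rewrite AB0.
(* The exponent killing [u] is positive, hence some [n.+1], and [iterB n] is then the goal [B x]
   itself. *)
case: (htors u) => -[//|n] _ un.
by have := iterB n; rewrite un mul1g.
Qed.

(** With at most two pieces, [S] would be all of [G]: no piece covers nothing, one translate covers
    [G] only if its piece is already [G], and two disjoint pieces are handled by torsion. *)
Lemma torsion_translates_gt2 (G : groupType) (htors : torsion_group G)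
    (S : set G) (gamma : G -> G) (n : nat) :
  set_surj S setT gamma -> translates_by_pieces S gamma n ->
  S <> setT -> (2 < n)%N.
Proof.
move=> surj [P [g [[covP trivP _] Pg]]] SnT.
have cov y : exists i, exists2 x, P i x & y = (g i * x)%g.
  have [x Sx <-] := surj y I.
  by move: Sx; rewrite -covP => -[i _ Pix]; exists i, x => //; apply: Pg.
have PS i x : P i x -> S x by move=> Pix; rewrite -covP; exists i.
rewrite ltnNge; apply/negP => n2; apply: SnT; apply/seteqP; split=> // x _.
case: n => [|[|[|//]]] in P g trivP covP Pg cov PS n2 *.
- by case: (cov x) => -[].
- case: (cov (g ord0 * x)%g) => i [y Piy]; rewrite (ord1 i) => /mulgI ->.
  exact: PS _ _ Piy.
- have P01 : (P ord0 `&` P ord_max = set0)%classic.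
    by move/trivIsetP : trivP; apply.
  have cov2 y : (exists2 a, P ord0 a & y = (g ord0 * a)%g) \/
                (exists2 b, P ord_max b & y = (g ord_max * b)%g).
    case: (cov y) => i; case: (unliftP ord0 i) => [j|] ->; last by left.
    by rewrite (_ : lift ord0 j = ord_max); [right | apply/val_inj; rewrite (ord1 j)].
  by case: (torsion_two_translates_cover G htors _ _ _ _ P01 cov2 x); exact: PS.
Qed.

Theorem proposition21 (R : realType) (G : groupType)
    (hna : ~ amenable G R) (htors : torsion_group G) :
  6%:R%:E <= tarski_number G R.
Proof.
rewrite /tarski_number asboolF //.
apply: le_ereal_inf_tmp => _ [n [X1 [X2 [f1 [f2 [n1 [n2 dec]]]]]] <-].
move: dec => [[_ X120 [[_ _ surj1] _] [[_ _ surj2] _]] [t1 _] [t2 _] ->].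
(* Preimages of [1] make both halves nonempty; as they are disjoint, neither is the whole group. *)
have [x1 Xx1 _] := surj1 1%g I; have [x2 Xx2 _] := surj2 1%g I.
have X1nT : X1 <> setT.
  by move=> X1T; move: X120; rewrite X1T setTI => X20; rewrite X20 in Xx2.
have X2nT : X2 <> setT.
  by move=> X2T; move: X120; rewrite X2T setIT => X10; rewrite X10 in Xx1.
have n1_gt2 := torsion_translates_gt2 G htors _ _ _ surj1 t1 X1nT.
have n2_gt2 := torsion_translates_gt2 G htors _ _ _ surj2 t2 X2nT.
by rewrite lee_fin Num.Theory.ler_nat (leq_add n1_gt2 n2_gt2).
Qed.
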